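(* Let $k \geq 2$ be an integer. For any sequence $\{F_n(k)\}_{n \geq 0}$ of complex numbers satisfying $F_n(k) = F_{n-1}(k) + F_{n-2}(k) + \dots + F_{n-k}(k)$ for all $n \geq k$, we have, for all $n \geq 0$, $$F_n(k) = \sum_{j=0}^{k-1} F_j(k)\, B_n(k,j).$$
   Context: For integers $k \geq 2$ and $0 \leq j \leq k-1$, the sequence $\{B_n(k,j)\}_{n\geq 0}$ is defined by the recurrence $B_n(k,j) = B_{n-1}(k,j) + B_{n-2}(k,j)+\dots+B_{n-k}(k,j)$ for all $n \geq k$, with initial values $B_j(k,j)=1$ and $B_i(k,j)=0$ for $0 \leq i \leq k-1$, $i \neq j$. *)

(* Defs.v *)
From mathcomp Require Import all_boot all_order all_algebra.
From mathcomp Require Import reals complex.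
Set Implicit Arguments.
Unset Strict Implicit.
Unset Printing Implicit Defensive.
Import GRing.Theory.
Local Open Scope ring_scope.

Definition kstep_rec (V : nmodType) (k : nat) (u : nat -> V) : Prop :=
  forall n : nat, (k <= n)%N -> u n = \sum_(1 <= i < k.+1) u (n - i)%N.

(* [:: B_0(k, j); ...; B_(n-1)(k, j)], each new term being computed from the
   terms already in the list. *)
Fixpoint Bseq (k j n : nat) : seq nat :=
  if n is m.+1 then
    let s := Bseq k j m in
    rcons s (if (m < k)%N then nat_of_bool (m == j)
             else \sum_(1 <= i < k.+1) nth 0 s (m - i))%N
  else [::].

(* B_n(k, j); its defining properties are B_init and B_rec below. *)
Definition B (k j n : nat) : nat := nth 0%N (Bseq k j n.+1) n.

Lemma size_Bseq k j n : size (Bseq k j n) = n.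
Proof. by elim: n => //= n IHn; rewrite size_rcons IHn. Qed.

Lemma nth_Bseq k j n m : (m < n)%N -> nth 0%N (Bseq k j n) m = B k j m.
Proof.
elim: n => // n IHn; rewrite ltnS leq_eqVlt => /predU1P[-> //|lt_mn].
by rewrite /= nth_rcons size_Bseq lt_mn IHn.
Qed.

Lemma B_init k j n : (n < k)%N -> B k j n = (n == j).
Proof. by move=> lt_nk; rewrite /B /= nth_rcons size_Bseq ltnn eqxx lt_nk. Qed.

Lemma B_rec k j : kstep_rec k (B k j).
Proof.
move=> n le_kn; rewrite {1}/B /= nth_rcons size_Bseq ltnn eqxx ltnNge le_kn /=.
apply: eq_big_nat => i /andP[i_gt0 le_ik].
by rewrite nth_Bseq // ltn_subrL i_gt0 (leq_trans _ le_kn) // (leq_trans i_gt0).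
Qed.

(* Main.v *)
(* A sequence satisfying the k-step recurrence is determined by its terms of
   index < k. Both sides satisfy the recurrence, the right-hand side by
   linearity, and they agree below k because there B k j n is the Kronecker
   delta. *)
Require Import Defs.
From mathcomp Require Import all_boot all_order all_algebra.
From mathcomp Require Import reals complex.
Import GRing.Theory.
Local Open Scope ring_scope.

(** Strong induction: for [k <= n] the recurrence involves only indices [n - i < n]. *)
Lemma kstep_rec_inj (V : nmodType) (k : nat) (u v : nat -> V) :
  kstep_rec k u -> kstep_rec k v ->
  (forall n, (n < k)%N -> u n = v n) -> forall n, u n = v n.
Proof.
move=> uP vP uv n; elim/ltn_ind: n => n IHn.
have [/uv //|le_kn] := ltnP n k.
rewrite uP // vP //; apply: eq_big_nat => i /andP[i_gt0 le_ik].
apply: IHn.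
(* With truncated subtraction, [n - i < n] also needs [0 < n]; this follows from
   [0 < i <= k <= n]. *)
by rewrite ltn_subrL i_gt0 (leq_trans _ le_kn) // (leq_trans i_gt0).
Qed.

Lemma kstep_rec_combB (A : pzSemiRingType) (k : nat) (a : nat -> A) :
  kstep_rec k (fun n => \sum_(0 <= j < k) a j * (B k j n)%:R).
Proof.
(* Once the sum over [j] is outermost on the right, the recurrence of each [B k j] applies
   termwise. *)
move=> n le_kn; rewrite exchange_big /=; apply: eq_bigr => j _.
by rewrite B_rec // natr_sum mulr_sumr.
Qed.

Lemma sum_B_init (A : pzSemiRingType) (k : nat) (a : nat -> A) (n : nat) :
  (n < k)%N -> \sum_(0 <= j < k) a j * (B k j n)%:R = a n.
Proof.
move=> lt_nk; rewrite big_mkord (bigD1 (Ordinal lt_nk)) //= B_init // eqxx.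
rewrite mulr1 big1 ?addr0 // => j neq_jn.
(* Equality of ordinals is by computation equality of their values, so [neq_jn] makes the Kronecker
   delta vanish. *)
by rewrite B_init // eq_sym -[_ == _]/(j == Ordinal lt_nk) (negPf neq_jn) mulr0.
Qed.

Theorem theorem1 (R : realType) (k : nat) (hk : (2 <= k)%N)
    (F : nat -> R[i]) (hF : kstep_rec k F) (n : nat) :
  F n = \sum_(0 <= j < k) F j * (B k j n)%:R.
Proof.
apply: (kstep_rec_inj _ _ _ _ hF (kstep_rec_combB _ k F)) => m lt_mk.
by rewrite sum_B_init.
Qed.
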